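(* Let $K$ be a field of prime characteristic $p>0$ and let $L=K(\theta)\simeq K[x]/(f(x))$ be a simple finite field extension of $K$, where $f(x)=f^{sep}(x^{p^n})=\sum_{i=0}^s\lambda_i x^{ip^n}\in K[x]$ (with $\lambda_i\in K$, $\lambda_s=1$) is the monic irreducible minimal polynomial of $\theta$ over $K$, written in its separable presentation. Let $m:=m_f$. Then: 1. $L^{sep}=K(\theta^{p^n})\simeq K[x]/(f^{sep}(x))$, $[L^{sep}:K]=\deg(f^{sep})=s$, and $f^{sep}(x)$ is a monic irreducible polynomial in $K[x]$ which is the minimal polynomial of $\theta^{p^n}$ over $K$. 2. $L^{pi}=K\big(\lambda_0^{1/p^m},\ldots,\lambda_{s-1}^{1/p^m}\big)$, $[L^{pi}:K]=p^m$, and $$m=\max\{m'\in\{0,1,\ldots,n\} \mid \theta^{p^{n-m'}}\in L^{pi}L^{sep}\}=\max\{m'\in\{0,1,\ldots,n\}\mid L^{p^{n-m'}}\subseteq L^{pi}L^{sep}\}.$$ In particular, $m$ is an isomorphism invariant of the field extension $L/K$ (it does not depend on the choice of the generator $\theta$). 3. $L^{pi}L^{sep}=L^{pi}\otimes_K L^{sep}=L^{pi}(\theta^{p^{n-m}})\simeq L^{pi}[x]/\big(f^{sep\frac{1}{p^m}}\big)$, $[L^{pi}L^{sep}:L^{pi}]=s$, $[L^{pi}L^{sep}:L^{sep}]=p^m$, and the polynomial $f^{sep\frac{1}{p^m}}:=\sum_{i=0}^s\lambda_i^{1/p^m}x^i$ is a monic irreducible polynomial in $L^{pi}[x]$ which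 is the minimal polynomial of $\theta^{p^{n-m}}$ over $L^{pi}$. 4. $L=(L^{pi}L^{sep})(\theta)\simeq (L^{pi}L^{sep})[x]/\big(x^{p^{n-m}}-\theta^{p^{n-m}}\big)$, $[L:L^{pi}L^{sep}]=p^{n-m}$, and $x^{p^{n-m}}-\theta^{p^{n-m}}$ is a monic irreducible polynomial in $(L^{pi}L^{sep})[x]$ which is the minimal polynomial of $\theta$ over $L^{pi}L^{sep}=L^{pi}\otimes_K L^{sep}$. The finite field extension $L/L^{pi}L^{sep}$ is a simple purely inseparable extension of exponent $n-m$. 5. $(L/L^{pi})^{sep}=L^{pi}L^{sep}$, i.e. the maximal separable subextension of $L/L^{pi}$ is $L^{pi}L^{sep}/L^{pi}$.
   Context: Fix an algebraic closure $\overline{K}$ of $K$ containing all fields considered. For $\lambda\in\overline{K}$ and $k\ge 0$, $\lambda^{1/p^k}$ denotes the unique $p^k$-th root of $\lambda$ in $\overline{K}$. For a finite extension $L/K$, $L^{sep}=(L/K)^{sep}$ and $L^{pi}=(L/K)^{pi}$ are the maximal separable and the maximal purely inseparable subextensions of $L/K$; $AB$ denotes the compositum in $\overline{K}$. The equality $L^{pi}L^{sep}=L^{pi}\otimes_K L^{sep}$ means that the natural $K$-algebra map $L^{pi}\otimes_K L^{sep}\to L^{pi}L^{sep}$, $a\otimes b\mapsto ab$, is an isomorphism. For a field $E$, $E^{p^k}=\{e^{p^k}\mid e\in E\}$. The exponent of a finite purely inseparable extension $E/F$ is the least $e\ge 0$ with $E^{p^e}\subseteq F$. Separable presentation: every non-scalar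 $f\in K[x]$ considered is written uniquely as $f(x)=f^{sep}(x^{p^n})$ with $f^{sep}\in K[x]$ a separable polynomial and $n\ge 0$; $n$ is the inseparability degree of $f$. Here $f^{sep}(x)=\sum_{i=0}^s\lambda_i x^i$. The number $m_f$ is defined by $m_f:=\max\{m'\in\{0,1,\ldots,n\}\mid \lambda_i^{1/p^{m'}}\in L\text{ for all } i=0,\ldots,s-1\}$. *)

(* Defs.v *)
From HB Require Import structures.
From mathcomp Require Import all_boot all_order all_algebra all_field.
From mathcomp Require Import boolp classical_sets.

Set Implicit Arguments.
Unset Strict Implicit.
Unset Printing Implicit Defensive.

Import GRing.Theory.
Local Open Scope ring_scope.
Local Open Scope classical_set_scope.

Section Presentation.
Variable K : fieldType.

(* f(x) = fsep(x^{p^n}) with fsep separable *)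
Definition separable_presentation (p : nat) (f fsep : {poly K}) (n : nat) :=
  separable_poly fsep /\ f = fsep \Po 'X^(p ^ n)%N.

End Presentation.

(* The p^k-th root of x in a fixed algebraic closure of L is unique in
   characteristic p, so it lies in L exactly when x is a p^k-th power in L. *)
Section PthRoot.
Variable L : fieldType.

Definition has_pth_root (p k : nat) (x : L) : Prop :=
  exists y : L, y ^+ (p ^ k) = x.

(* junk value 0 when x has no p^k-th root in L *)
Definition pth_root (p k : nat) (x : L) : L :=
  xget 0 [set y : L | y ^+ (p ^ k) = x].

Lemma pth_rootP p k x : has_pth_root p k x -> pth_root p k x ^+ (p ^ k) = x.
Proof. exact: (@xgetPex _ 0 [set y : L | y ^+ (p ^ k) = x]). Qed.

Lemma pth_root_unique p k x y :
  p \in [pchar L] -> y ^+ (p ^ k) = x -> pth_root p k x = y.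
Proof.
move=> pL yx; apply: xget_unique => // z zx; apply/eqP; rewrite -subr_eq0.
have pn : [pchar L].-nat (p ^ k)%N.
  by rewrite pnatX pnatE ?pL // (pcharf_prime pL).
have: (z - y) ^+ (p ^ k) == 0.
  by rewrite exprDn_pchar // exprNn_pchar // zx yx subrr.
by rewrite expf_eq0 => /andP[].
Qed.

End PthRoot.

Section Extensions.
Variables (K : fieldType) (L : fieldExtType K).
Implicit Types (F E M : {subfield L}).

Definition is_maximal_subext (P : {subfield L} -> Prop) F E M : Prop :=
  [/\ (F <= M <= E)%VS, P M &
      forall M', (F <= M' <= E)%VS -> P M' -> (M' <= M)%VS].

(* the default F is never reached for max_sep and max_pi when F <= E: see
   max_sepP and max_piP *)
Definition maximal_subext (P : {subfield L} -> Prop) F E : {subfield L} :=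
  xget F [set M | is_maximal_subext P F E M].

(* (E/F)^sep and (E/F)^pi *)
Definition max_sep F E := maximal_subext (fun M => separable F M) F E.
Definition max_pi F E := maximal_subext (fun M => purely_inseparable F M) F E.

Lemma max_sepP F E : (F <= E)%VS ->
  is_maximal_subext (fun M => separable F M) F E (max_sep F E).
Proof.
move=> sFE; apply: (@xgetPex _ F
  [set M | is_maximal_subext (fun M => separable F M) F E M]).
exists <<F; separable_generator F E>>%AS; split.
- rewrite subv_adjoin; apply/FadjoinP.
  by rewrite sFE separable_generator_mem.
- by rewrite -adjoin_separable_eq separable_generatorP.
move=> M' /andP[sFM sME] sep; apply/subvP => v Mv.
rewrite -separable_inseparable_element.
have /purely_inseparableP-> := separable_generator_maximal E F.
  rewrite (separable_elementS (subv_adjoin _ _)) //.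
  by move/separableP: sep; apply.
exact: (subvP sME).
Qed.

Lemma max_piP F E : (F <= E)%VS ->
  is_maximal_subext (fun M => purely_inseparable F M) F E (max_pi F E).
Proof.
move=> sFE; apply: (@xgetPex _ F
  [set M | is_maximal_subext (fun M => purely_inseparable F M) F E M]).
pose Q d := `[< exists M, [/\ (F <= M <= E)%VS, purely_inseparable F M
                          & \dim M = d] >].
have exQ : exists d, Q d.
  exists (\dim F); apply/asboolP; exists F; split => //.
    by rewrite subvv.
  exact: purely_inseparable_refl.
have leQ d : Q d -> (d <= \dim E)%N.
  by move/asboolP => [M [/andP[_ sME] _ <-]]; exact: dimvS.
case: (ex_maxnP exQ leQ) => d /asboolP[M [/andP[sFM sME] piM dM]] maxd.
exists M; split; rewrite ?sFM // => M' /andP[sFM' sM'E] piM'.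
have sMMM : (M <= M * M')%VS by exact: field_subvMr.
have sMMM' : (M' <= M * M')%VS by exact: field_subvMl.
have: (\dim (M * M') <= d)%N.
  apply: maxd; apply/asboolP; exists (M * M')%AS; split => //.
    by rewrite (subv_trans sFM) //= prodv_sub.
  apply: (purely_inseparable_trans piM); apply/purely_inseparableP => z.
  have -> : (M * M')%AS = <<allpairs *%R (vbasis M) (vbasis M')>>%VS
    :> {vspace L}.
    exact: (f_equal (fun f => f _ _) (unlock (prodv_unlockable L))).
  move=> /coord_span->; apply: inseparable_sum => i _.
  set w := _`_i; have : w \in allpairs *%R (vbasis M) (vbasis M').
    exact/memt_nth.
  case/allpairsP => -[x y] /= [/vbasis_mem Mx /vbasis_mem My ->].
  move/purely_inseparableP: piM' => /(_ y My).
  case/purely_inseparable_elementP_pchar => k pk Fyk.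
  apply/purely_inseparable_elementP_pchar; exists k => //.
  rewrite exprZn rpredZ // exprMn rpredM //; first exact: rpredX.
  exact: (subvP sFM).
rewrite -dM => led.
have /eqP eM : M == (M * M')%VS :> {vspace L}.
  by rewrite eqEdim sMMM led.
by rewrite eM.
Qed.

(* E^{p^k} *)
Definition frobenius_image (p k : nat) (E : {vspace L}) : set L :=
  [set x ^+ (p ^ k) | x in [set` E]].

(* the exponent of E/F *)
Definition is_exponent (p : nat) (F E : {vspace L}) (e : nat) : Prop :=
  frobenius_image p e E `<=` [set` F] /\
  forall e', frobenius_image p e' E `<=` [set` F] -> (e <= e')%N.

(* m_f, for f = fsep(x^{p^n}); the condition always holds for m' = 0 *)
Definition m_of (p : nat) (fsep : {poly K}) (n : nat) : nat :=
  \max_(m' < n.+1 | `[< forall i, (i < (size fsep).-1)%N ->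
                          has_pth_root p m' ((fsep`_i)%:A : L) >]) m'.

(* \sum_i lambda_i^{1/p^k} x^i, where the lambda_i are the coefficients of g *)
Definition root_poly (p k : nat) (g : {poly K}) : {poly L} :=
  \sum_(i < size g) (pth_root p k ((g`_i)%:A : L)) *: 'X^i.

(* a polynomial with coefficients in F, as an element of F[x] *)
Definition poly_in F (P : {poly L}) : {poly subvs_of F} :=
  map_poly (vsproj F) P.

Definition is_irreducible_minPoly F (P : {poly L}) (z : L) : Prop :=
  [/\ P \is a polyOver F, P \is monic, irreducible_poly (poly_in F P)
    & minPoly F z = P].

(* R[x]/(q) is isomorphic to E over R, the class of x being sent to z; here R
   is viewed inside L through iota. *)
Definition quotient_iso (R : fieldType) (iota : R -> L) (q : {poly R})
    (E : {subfield L}) (z : L) : Prop :=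
  exists2 g : {rmorphism {poly %/ q} -> subvs_of E}, bijective g
    & forall r : {poly R}, vsval (g (in_qpoly q r)) = (map_poly iota r).[z].

End Extensions.

Arguments m_of {K} L p fsep n.
Arguments root_poly {K} L p k g.

Section Tensor.
Variables (K : fieldType) (A B : algType K).

Definition bilinear_map (W : lmodType K) (phi : A -> B -> W) : Prop :=
  (forall a, linear (phi a)) /\ (forall b, linear (phi^~ b)).

(* (T, t) is the K-algebra A \otimes_K B: the underlying vector space satisfies
   the universal property of the tensor product, and pure tensors multiply
   componentwise. *)
Definition is_tensor_algebra (T : algType K) (t : A -> B -> T) : Prop :=
  [/\ bilinear_map t,
      forall (W : lmodType K) (phi : A -> B -> W), bilinear_map phi ->
        exists g : {linear T -> W}, forall a b, g (t a b) = phi a b,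
      forall (W : lmodType K) (g1 g2 : {linear T -> W}),
        (forall a b, g1 (t a b) = g2 (t a b)) -> g1 =1 g2,
      t 1 1 = 1
    & forall a a' b b', t a b * t a' b' = t (a * a') (b * b')].

End Tensor.

(* The natural map E \otimes_K F -> EF, a \otimes b |-> ab, is an isomorphism
   of K-algebras. *)
Definition compositum_is_tensor (K : fieldType) (L : fieldExtType K)
    (E F : {subfield L}) : Prop :=
  exists (T : algType K) (t : subvs_of E -> subvs_of F -> T)
         (mu : {lrmorphism T -> subvs_of (E * F)%AS}),
    [/\ is_tensor_algebra t,
        forall a b, vsval (mu (t a b)) = vsval a * vsval b
      & bijective mu].

(* Main.v *)
(* Since the p-powers of theta generate a chain of fields under L, everything
   is read off from minimal polynomials. Raising coefficients to a high p-power
   shows that a separable element keeps its degree over a purely inseparable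
   extension; hence theta^(p^n), which generates L^sep, still has minimal
   polynomial fsep over L^pi, and M = L^pi L^sep has degree s over L^pi. For
   k <= n the element x = theta^(p^(n-k)) lies in M iff fsep^(1/p^k) has its
   coefficients in L: if it does, x is a root of this separable polynomial over
   L^pi; conversely the minimal polynomial of x over L^pi has degree s and
   becomes fsep after raising its coefficients to the power p^k. So
   theta^(p^i) enters M exactly at i = n - m, which gives [L : M] = p^(n-m),
   and the remaining degrees follow by counting. In particular
   p^m = [L^pi : K] does not depend on theta. *)
Require Import Defs.
From HB Require Import structures.
From mathcomp Require Import all_boot all_order all_algebra all_field.
From mathcomp Require Import boolp classical_sets.

Set Implicit Arguments.
Unset Strict Implicit.
Unset Printing Implicit Defensive.

Import GRing.Theory.
Local Open Scope ring_scope.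
Local Open Scope classical_set_scope.

(** * The iterated Frobenius as a ring morphism *)

Section FrobeniusPower.
Variables (R : comNzRingType) (p : nat) (charR : p \in [pchar R]) (k : nat).

Lemma pchar_nat_expn : [pchar R].-nat (p ^ k)%N.
Proof. by rewrite pnatX pnatE ?charR // (pcharf_prime charR). Qed.

(** The proof of [p \in [pchar R]] is a dummy argument of the function, so that the morphism
    structures, which depend on it, can be attached to [Frobenius_pow charR]. *)
Definition Frobenius_pow of p \in [pchar R] := fun x : R => x ^+ (p ^ k).

Fact Frobenius_pow_is_zmod_morphism : zmod_morphism (Frobenius_pow charR).
Proof.
move=> x y; rewrite /Frobenius_pow exprDn_pchar ?pchar_nat_expn //.
by rewrite exprNn_pchar ?pchar_nat_expn.
Qed.

Fact Frobenius_pow_is_monoid_morphism : monoid_morphism (Frobenius_pow charR).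
Proof.
by split=> [|x y]; rewrite /Frobenius_pow ?expr1n ?exprMn.
Qed.

HB.instance Definition _ := GRing.isZmodMorphism.Build R R
  (Frobenius_pow charR) Frobenius_pow_is_zmod_morphism.
HB.instance Definition _ := GRing.isMonoidMorphism.Build R R
  (Frobenius_pow charR) Frobenius_pow_is_monoid_morphism.

Lemma horner_Frobenius_pow (q : {poly R}) (x : R) :
  (map_poly (Frobenius_pow charR) q).[x ^+ (p ^ k)] = q.[x] ^+ (p ^ k).
Proof. exact: (horner_map (Frobenius_pow charR)). Qed.

End FrobeniusPower.

(** * Minimal polynomials in characteristic p *)

Section MinPoly.
Variables (K : fieldType) (L : fieldExtType K).
Implicit Types (F E M : {subfield L}) (x z : L).

(** A bound on the degree stands in for irreducibility: [minPoly F z] divides P, so the bound makes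
    the two associated, and both are monic. *)
Lemma minPoly_unique F z (P : {poly L}) :
    P \is a polyOver F -> P \is monic -> root P z ->
    (size P <= size (minPoly F z))%N ->
  minPoly F z = P.
Proof.
move=> FP monP Pz szP; apply/eqP; rewrite -eqp_monic ?monic_minPoly //.
have dvP := minPoly_dvdp FP Pz.
by rewrite -dvdp_size_eqp // eqn_leq szP dvdp_leq ?monic_neq0.
Qed.

(** Degrees are squeezed: deg q <= [E : F] <= [F(z) : F] <= deg q, the last because the minimal
    polynomial of z divides q. *)
Lemma minPoly_eq_Fadjoin_dim F E z (q : {poly L}) :
    (F <= E)%VS -> q \is a polyOver F -> q \is monic -> root q z ->
    (size q <= (\dim_F E).+1)%N -> (E <= <<F; z>>)%VS ->
  minPoly F z = q /\ (E : {vspace L}) = <<F; z>>%VS.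
Proof.
move=> sFE Fq mq qz szq sE.
have le1 : (\dim_F E <= \dim_F <<F; z>>)%N.
  by rewrite leq_div2r // dimvS.
have def_q : minPoly F z = q.
  apply: minPoly_unique => //.
  by rewrite size_minPoly adjoin_degreeE (leq_trans szq).
split=> //; apply/eqP; rewrite eqEdim sE /=.
rewrite (dim_sup_field sFE) dim_Fadjoin leq_mul2r; apply/orP; right.
by rewrite -ltnS -size_minPoly def_q.
Qed.

(** If v = q(x), then v^(p^k) is the value at x^(p^k) of q with its coefficients raised to the power
    p^k. *)
Lemma expr_Fadjoin_mem p k F x v :
    p \in [pchar L] -> x ^+ (p ^ k) \in F -> v \in <<F; x>>%VS ->
  v ^+ (p ^ k) \in F.
Proof.
move=> charL Fxk /Fadjoin_polyP[q Fq ->].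
rewrite -(horner_Frobenius_pow charL) rpred_horner //.
by apply/polyOverP => i; rewrite coef_map /= rpredX // (polyOverP Fq).
Qed.

Lemma purely_inseparable_Fadjoin p k F x :
    p \in [pchar L] -> x ^+ (p ^ k) \in F -> purely_inseparable F <<F; x>>.
Proof.
move=> charL Fxk; apply/purely_inseparableP => v Fv.
apply/purely_inseparable_elementP_pchar; exists (p ^ k)%N.
  exact: pchar_nat_expn.
exact: expr_Fadjoin_mem Fv.
Qed.

Lemma pchar_pnat p d : p \in [pchar L] -> [pchar L].-nat d ->
  exists k, d = (p ^ k)%N.
Proof.
move=> charL; rewrite (eq_pnat _ (pcharf_eq charL)) => /p_natP[k ->].
by exists k.
Qed.

Lemma memv_Fadjoin_expr p k F x :
    p \in [pchar L] -> separable_element F x -> x \in <<F; x ^+ (p ^ k)>>%VS.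
Proof.
case: k => [|k] charL sepx; first by rewrite expr1 memv_adjoin.
by rewrite -pcharf_p_separable.
Qed.

Lemma Fadjoin_expr p k F x :
    p \in [pchar L] -> separable_element F x ->
  <<F; x ^+ (p ^ k)>>%VS = <<F; x>>%VS.
Proof.
move=> charL sepx; apply/eqP; rewrite eqEsubv; apply/andP; split.
  by apply/FadjoinP; rewrite subv_adjoin rpredX ?memv_adjoin.
by apply/FadjoinP; rewrite subv_adjoin memv_Fadjoin_expr.
Qed.

(* Raising the coefficients of a polynomial over E to a high p-power gives a
   polynomial over F of the same degree vanishing at x^(p^k), and
   F(x^(p^k)) = F(x). *)
Lemma minPoly_purely_inseparable p F E x :
    p \in [pchar L] -> (F <= E)%VS -> purely_inseparable F E ->
    separable_element F x ->
  minPoly E x = minPoly F x.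
Proof.
move=> charL sFE /purely_inseparableP piE sepx.
apply: minPoly_unique; rewrite ?monic_minPoly ?root_minPoly //.
  exact: polyOverSv sFE _ (minPolyOver _ _).
set q := minPoly E x.
have /boolp.choice[k kP] : forall i, exists k, q`_i ^+ (p ^ k) \in F.
  move=> i; have /piE : q`_i \in E by exact/polyOverP/minPolyOver.
  case/purely_inseparable_elementP_pchar => d /(pchar_pnat charL)[k ->].
  by exists k.
(* One exponent for all coefficients: the sum is at least each [k i], and further powers stay in
   F. *)
pose e := (\sum_(i < size q) k i)%N.
have eP i : q`_i ^+ (p ^ e) \in F.
  case: (ltnP i (size q)) => [lti | lei]; last first.
    rewrite nth_default // expr0n expn_eq0.
    by rewrite (gtn_eqF (prime_gt0 (pcharf_prime charL))) rpred0.
  rewrite /e (bigD1 (Ordinal lti)) //= expnD exprM rpredX //.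
have Fq : map_poly (Frobenius_pow e charL) q \is a polyOver F.
  by apply/polyOverP => i; rewrite coef_map /=; apply: eP.
have qx : root (map_poly (Frobenius_pow e charL) q) (x ^+ (p ^ e)).
  rewrite /root horner_Frobenius_pow expf_eq0 minPolyxx eqxx andbT.
  by rewrite expn_gt0 prime_gt0 ?(pcharf_prime charL).
have nzq : map_poly (Frobenius_pow e charL) q != 0.
  by rewrite map_poly_eq0 monic_neq0 ?monic_minPoly.
have := dvdp_leq nzq (minPoly_dvdp Fq qx).
by rewrite size_map_poly !size_minPoly !adjoin_degreeE Fadjoin_expr.
Qed.

(** The candidate is (X - x)^(p^k), so the minimal polynomial is (X - x)^d for some d <= p^k. If d <
    p^k, its constant coefficient leads to some x^(p^i) in F with i < k. *)
Lemma minPoly_expr_pchar p k F x :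
    p \in [pchar L] -> x ^+ (p ^ k) \in F ->
    (forall i, (i < k)%N -> x ^+ (p ^ i) \notin F) ->
  minPoly F x = 'X^(p ^ k) - (x ^+ (p ^ k))%:P.
Proof.
move=> charL Fxk nFx.
have pk0 : (0 < p ^ k)%N by rewrite expn_gt0 prime_gt0 ?(pcharf_prime charL).
have defP : 'X^(p ^ k) - (x ^+ (p ^ k))%:P = ('X - x%:P) ^+ (p ^ k).
  have charX : p \in [pchar {poly L}] by rewrite pchar_poly.
  rewrite polyC_exp exprDn_pchar ?pchar_nat_expn //.
  by rewrite exprNn_pchar ?pchar_nat_expn.
have FP : 'X^(p ^ k) - (x ^+ (p ^ k))%:P \is a polyOver F.
  by rewrite rpredB ?rpredX ?polyOverX ?polyOverC.
have monP : 'X^(p ^ k) - (x ^+ (p ^ k))%:P \is monic.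
  by rewrite monicXnsubC.
apply: minPoly_unique => //.
  by rewrite defP /root !hornerE subrr expr0n gtn_eqF.
rewrite size_XnsubC //.
(* The Bezout argument below divides by a power of x. When x = 0, the hypothesis at i = 0 leaves
   only k = 0. *)
have [x0 | nzx] := eqVneq x 0.
  case: k nFx pk0 {Fxk defP FP monP} => [|k] nFx pk0.
    by rewrite size_minPoly.
  by have := nFx 0%N isT; rewrite x0 expr1 rpred0.
have Px : root ('X^(p ^ k) - (x ^+ (p ^ k))%:P) x.
  by rewrite defP /root !hornerE subrr expr0n gtn_eqF.
have := minPoly_dvdp FP Px; rewrite defP => /dvdp_exp_XsubCP[d le_d].
rewrite eqp_monic ?monic_minPoly ?monic_exp ?monicXsubC // => /eqP def_d.
(* The constant coefficient of (X - x)^d is (-1)^d x^d; the sign is cancelled by multiplying with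
   (-1)^d, again in F. *)
have Fd : x ^+ d \in F.
  have := polyOverP (minPolyOver F x) 0%N.
  rewrite def_d -horner_coef0 !hornerE exprNn.
  move/(rpredM (rpredX d (rpredN1 F))).
  by rewrite mulrA -expr2 sqrr_sign mul1r.
rewrite def_d size_exp_XsubC ltnS leqNgt; apply/negP => lt_d.
have d0 : (0 < d)%N.
  by rewrite -ltnS -(size_exp_XsubC d x) -def_d size_minPoly.
(* Bezout: x^d and x^(p^k) in F give x^gcd(d, p^k) in F. *)
have [g [g_pk g_d Fg]] : exists g,
    [/\ (g %| p ^ k)%N, (g %| d)%N & x ^+ g \in F].
  exists (gcdn d (p ^ k)); rewrite dvdn_gcdl dvdn_gcdr; split => //.
  case: (egcdnP (p ^ k) d0) => a b def_g _.
  have -> : x ^+ gcdn d (p ^ k) = x ^+ (a * d) / x ^+ (b * p ^ k).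
    by rewrite def_g exprD mulrAC mulfV ?mul1r // expf_neq0.
  by rewrite rpred_div // mulnC exprM rpredX.
case/(dvdn_pfactor _ _ (pcharf_prime charL)): g_pk => i le_ik def_g.
rewrite def_g in g_d Fg.
have [ltik | leki] := ltnP i k; first by have := nFx i ltik; rewrite Fg.
have eq_ik : i = k by apply/anti_leq; rewrite le_ik.
by move: lt_d; rewrite ltnNge -eq_ik dvdn_leq.
Qed.

(** An element of E separable over F is both separable and purely inseparable over M, hence lies in
    M. *)
Lemma max_sep_unique F M E :
    (F <= M <= E)%VS -> separable F M -> purely_inseparable M E ->
  max_sep F E = M.
Proof.
move=> sFME sepM /purely_inseparableP piE.
have /andP[sFM sME] := sFME; have sFE := subv_trans sFM sME.
have [/andP[_ sSE] /separableP sepS maxS] := max_sepP sFE.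
apply/val_inj/eqP; rewrite /= eqEsubv maxS // andbT.
apply/subvP => v Sv; rewrite -separable_inseparable_element piE ?(subvP sSE) //.
by rewrite (separable_elementS sFM) ?sepS.
Qed.

Lemma poly_inK F (P : {poly L}) :
  P \is a polyOver F -> map_poly vsval (poly_in F P) = P.
Proof.
move=> /polyOverP FP; apply/polyP => i.
by rewrite coef_map /= coef_map_id0 ?linear0 //= vsprojK.
Qed.

(** A factor over the type [subvs_of F] is mapped into L[x], where [minPoly_irr] applies, and the
    result is pulled back. *)
Lemma minPoly_is_irreducible F z (P : {poly L}) :
  minPoly F z = P -> is_irreducible_minPoly F P z.
Proof.
move=> <-; have FP := minPolyOver F z; split; rewrite ?monic_minPoly //.
split=> [|q szq dvq].
  by rewrite -(size_map_poly vsval) poly_inK // size_minPoly.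
have Fq : map_poly vsval q \is a polyOver F by apply/polyOver_subvs; exists q.
have PK := poly_inK FP.
have : map_poly vsval q %| minPoly F z by rewrite -PK dvdp_map.
move/(minPoly_irr Fq); rewrite -size_poly_eq1 size_map_poly (negPf szq) orbF.
by rewrite -{1}PK eqp_map.
Qed.

Lemma minPoly1_irreducible z (q : {poly K}) :
  minPoly 1 z = map_poly (in_alg L) q -> q \is monic /\ irreducible_poly q.
Proof.
move=> def_q; split.
  by rewrite -(map_monic (in_alg L)) -def_q monic_minPoly.
split=> [|r szr dvr].
  by rewrite -(size_map_poly (in_alg L)) -def_q size_minPoly.
have := @minPoly_irr _ _ 1%AS z (map_poly (in_alg L) r).
rewrite def_q dvdp_map dvr alg_polyOver => /(_ isT isT).
by rewrite -size_poly_eq1 size_map_poly (negPf szr) orbF eqp_map.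
Qed.

(** The isomorphism is evaluation at z. Taking F as the image of [iota] covers at once R = K with F
    = 1 and R = [subvs_of F] with [vsval]. *)
Lemma quotient_iso_Fadjoin (R : fieldType) (iota : {rmorphism R -> L})
    (q : {poly R}) F E z :
    (forall x, reflect (exists r, x = iota r) (x \in F)) ->
    minPoly F z = map_poly iota q -> (E : {vspace L}) = <<F; z>>%VS ->
  quotient_iso iota q E z.
Proof.
move=> Fiota def_q defE.
have FiotaP r : iota r \in F by apply/Fiota; exists r.
have iota_polyOver (r : {poly R}) : map_poly iota r \is a polyOver F.
  by apply/polyOverP => i; rewrite coef_map FiotaP.
have mq : q \is monic by rewrite -(map_monic iota) -def_q monic_minPoly.
(* The quotient is really taken modulo [mk_monic q], which agrees with q because q is monic and
   nonconstant. *)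
have def_mk : mk_monic q = q.
  by rewrite /mk_monic mq -(size_map_poly iota) -def_q size_minPoly.
have evE (r : {poly R}) : (map_poly iota r).[z] \in E.
  by rewrite memvE defE -memvE mempx_Fadjoin.
pose ev (r : {poly %/ q}) : subvs_of E := Subvs (evE r).
have ev_mod (r : {poly R}) :
  (map_poly iota (in_qpoly q r)).[z] = (map_poly iota r).[z].
  rewrite /= def_mk [in RHS](Pdiv.RingMonic.rdivp_eq mq r).
  rewrite rmorphD rmorphM /= -def_q.
  by rewrite hornerD hornerM minPolyxx mulr0 add0r.
have ev_zmod : zmod_morphism ev.
  by move=> r1 r2; apply/val_inj; rewrite /= rmorphB hornerD hornerN.
have ev_mon : monoid_morphism ev.
  split=> [|r1 r2]; apply/val_inj; rewrite /=.
    by rewrite rmorph1 hornerC algid1.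
  by rewrite ev_mod rmorphM hornerM.
pose evA := GRing.isZmodMorphism.Build _ _ ev ev_zmod.
pose evM := GRing.isMonoidMorphism.Build _ _ ev ev_mon.
pose g : {rmorphism {poly %/ q} -> subvs_of E} := HB.pack ev evA evM.
exists g; last exact: ev_mod.
(* A reduced representative has smaller degree than the minimal polynomial of z, so it vanishes at z
   only if it is 0. *)
have g_inj : injective g.
  apply: raddf_inj => r gr0; apply/val_inj/(map_poly_inj iota).
  rewrite /= rmorph0; apply/eqP; rewrite -(@root_small_adjoin_poly _ _ F z) //.
    by apply/rootP; rewrite -[LHS]/(val (g r)) gr0.
  rewrite size_map_poly -ltnS -size_minPoly def_q size_map_poly.
  by rewrite -[in X in (_ < X)%N]def_mk size_mk_monic.
(* Surjectivity: an element of F(z) is P(z) with P over F, and the coefficients of P are lifted one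
   by one through [iota]. *)
have /boolp.choice[h hK] : forall y : subvs_of E, exists r, g r = y.
  move=> y; have : vsval y \in <<F; z>>%VS by rewrite -defE subvsP.
  case/Fadjoin_polyP => P /polyOverP FP def_y.
  have /boolp.choice[r rP] : forall i, exists r, P`_i = iota r.
    by move=> i; exact/Fiota.
  exists (in_qpoly q (\poly_(i < size P) r i)); apply/val_inj.
  apply: etrans (etrans (ev_mod _) _) (esym def_y).
  congr (_.[z]); apply/polyP => i; rewrite coef_map coef_poly.
  case: ifP => [_ | /negbT]; first by rewrite rP.
  by rewrite -leqNgt => lei; rewrite (nth_default _ lei); exact: rmorph0.
by exists h => // r; apply: g_inj; rewrite hK.
Qed.

End MinPoly.

(** * The compositum as a tensor product *)

Section Compositum.
Variables (K : fieldType) (L : fieldExtType K).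
Implicit Types (E F : {subfield L}).

(** Bilinearity is a predicate on bare functions, so a linear structure is packed on the spot to use
    the library's sum lemmas. *)
Lemma linear_comb (V W : lmodType K) (f : V -> W) n (c : 'I_n -> K) v :
  linear f -> f (\sum_i c i *: v i) = \sum_i c i *: f (v i).
Proof.
move=> linf; pose fM := GRing.isLinear.Build _ _ _ _ f linf.
pose g : {linear V -> W} := HB.pack f fM.
rewrite -[f]/(g : V -> W) linear_sum; apply: eq_bigr => i _.
by rewrite linearZ.
Qed.

Lemma subvs_vbasis E (a : subvs_of E) :
  a = \sum_i coord (vbasis E) i (vsval a) *: vsproj E (vbasis E)`_i.
Proof.
apply/val_inj; rewrite /= {1}(coord_vbasis (subvsP a)) linear_sum.
apply: eq_bigr => i _; rewrite linearZ /= vsprojK //.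
by rewrite vbasis_mem ?memt_nth.
Qed.

Lemma bilinear_map_ext E F (W : lmodType K)
    (phi psi : subvs_of E -> subvs_of F -> W) :
    bilinear_map phi -> bilinear_map psi ->
    (forall x y, x \in vbasis E -> y \in vbasis F ->
      phi (vsproj E x) (vsproj F y) = psi (vsproj E x) (vsproj F y)) ->
  forall a b, phi a b = psi a b.
Proof.
move=> [phil phir] [psil psir] eq_pp a b.
rewrite [a]subvs_vbasis (linear_comb _ _ (phir b)) (linear_comb _ _ (psir b)).
apply: eq_bigr => i _; congr (_ *: _).
rewrite [b]subvs_vbasis !linear_comb //.
by apply: eq_bigr => j _; rewrite eq_pp ?memt_nth.
Qed.

(** EF itself serves as the tensor product, with the identity as comparison map. Products of basis
    vectors span EF, and by the dimension hypothesis they form a basis, on which linear maps can be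
    prescribed freely. *)
Lemma compositum_is_tensor_dim E F :
  \dim (E * F) = (\dim E * \dim F)%N -> compositum_is_tensor E F.
Proof.
move=> dimEF; pose T : algType K := subvs_of (E * F)%AS.
pose t (a : subvs_of E) (b : subvs_of F) : T :=
  Subvs (memv_mul (subvsP a) (subvsP b) : _ \in (E * F)%AS).
pose P := [seq (x, y) | x <- vbasis E, y <- vbasis F].
pose X := map (fun u => u.1 * u.2) P.
have szX : size X = (\dim E * \dim F)%N.
  by rewrite size_map size_allpairs !size_tuple.
have spanX : <<X>>%VS = (E * F)%VS.
  (* [prodv] is by definition the span of the products of basis vectors; its lock is opened here. *)
  by rewrite /X map_allpairs
             [RHS](f_equal (fun f => f _ _) (unlock (prodv_unlockable L))).
have freeX : free (in_tuple X) by rewrite /free /= spanX dimEF szX.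
have cX (i j : 'I_(size X)) : coord (in_tuple X) i X`_j = (j == i)%:R.
  by rewrite (coord_free j i freeX).
have bil_t : bilinear_map t.
  split=> [a | b] c u v; apply/val_inj => /=.
    by rewrite mulrDr scalerAr.
  by rewrite mulrDl scalerAl.
have memP k : (k < size X)%N ->
  (nth (0, 0) P k).1 \in vbasis E /\ (nth (0, 0) P k).2 \in vbasis F.
  move=> ltk; have /allpairsP[u [xE yF ->]] : nth (0, 0) P k \in P.
    by rewrite mem_nth // -(size_map (fun u => u.1 * u.2)).
  by [].
have nthX k : (k < size X)%N -> X`_k =
  val (t (vsproj E (nth (0, 0) P k).1) (vsproj F (nth (0, 0) P k).2)).
  move=> ltk; have [/vbasis_mem xE /vbasis_mem yF] := memP k ltk.
  rewrite /X (nth_map (0, 0)) /= ?vsprojK //.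
  by rewrite -(size_map (fun u => u.1 * u.2)).
exists T, t, idfun; split => //; last by exists idfun.
split.
- exact: bil_t.
- move=> W phi [phil phir].
  pose Y k := phi (vsproj E (nth (0, 0) P k).1) (vsproj F (nth (0, 0) P k).2).
  pose g (x : T) : W := \sum_(k < size X) coord (in_tuple X) k (vsval x) *: Y k.
  have g_lin : linear g.
    move=> c u v; rewrite /g scaler_sumr -big_split; apply: eq_bigr => k _ /=.
    by rewrite !linearP scalerDl scalerA.
  pose gM := GRing.isLinear.Build _ _ _ _ g g_lin.
  pose gl : {linear T -> W} := HB.pack g gM.
  exists gl; apply: bilinear_map_ext => //.
    split=> [a | b] c u v.
      by rewrite (bil_t.1 a) linearP.
    by rewrite (bil_t.2 b) linearP.
  move=> x y Ex Fy.
  have Pxy : (x, y) \in P by apply/allpairsP; exists (x, y).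
  have ltk : (index (x, y) P < size X)%N by rewrite size_map index_mem.
  have [k nthk] : exists k : 'I_(size X), nth (0, 0) P k = (x, y).
    by exists (Ordinal ltk); rewrite nth_index.
  have tE : val (t (vsproj E x) (vsproj F y)) = X`_k.
    by rewrite nthX // nthk.
  rewrite -[LHS]/(g _) /g tE (bigD1 k) //= big1 ?addr0.
    by rewrite cX eqxx scale1r /Y nthk.
  by move=> i neq_ik; rewrite cX eq_sym (negPf neq_ik) scale0r.
- move=> W g1 g2 eq_g x.
  have : vsval x \in <<in_tuple X>>%VS by rewrite /= spanX subvsP.
  move=> /coord_span def_x.
  have -> : x = \sum_(k < size X) coord (in_tuple X) k (vsval x) *:
    t (vsproj E (nth (0, 0) P k).1) (vsproj F (nth (0, 0) P k).2).
    apply/val_inj; rewrite [LHS]def_x /= linear_sum; apply: eq_bigr => k _.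
    by rewrite linearZ /= nthX.
  by rewrite !linear_sum; apply: eq_bigr => k _; rewrite !linearZ eq_g.
- by apply/val_inj; rewrite /= !algid1 mulr1.
- by move=> a a' b b'; apply/val_inj; rewrite /= mulrACA.
Qed.
End Compositum.

(** Since 0 is admissible, the index set is nonempty and the maximum is attained. *)
Lemma bigmax_ordP n (P : pred nat) (m := \max_(i < n.+1 | P i) i) :
  P 0%N -> [/\ (m <= n)%N, P m & forall i, (i <= n)%N -> P i -> (i <= m)%N].
Proof.
move=> P0; have [i Pi def_m] : exists2 i : 'I_n.+1, P i & m = i.
  have [|i Pi def_m] := @eq_bigmax_cond _ [pred i : 'I_n.+1 | P i] (@nat_of_ord _).
    by apply/card_gt0P; exists ord0.
  by exists i.
rewrite def_m -ltnS ltn_ord; split=> // j; rewrite -ltnS => ltj Pj.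
by rewrite -def_m (bigmax_sup (Ordinal ltj)).
Qed.

Lemma bigmax_ord_eq n (P : pred nat) m :
    (m <= n)%N -> P m -> (forall i, (i <= n)%N -> P i -> (i <= m)%N) ->
  (\max_(i < n.+1 | P i) i)%N = m.
Proof.
move=> le_mn Pm maxm; have lt_mn : (m < n.+1)%N by [].
apply/anti_leq; rewrite (bigmax_sup (Ordinal lt_mn)) // andbT.
by apply/bigmax_leqP => i Pi; rewrite maxm // -ltnS.
Qed.

(** * The simple extension L = K(theta) and its intermediate fields *)

Section SimpleExtension.
Variables (p : nat) (K : fieldType) (L : fieldExtType K).
Variables (theta : L) (f fsep : {poly K}) (n : nat).
Hypotheses (charK : p \in [pchar K]) (L_gen : <<1%VS; theta>>%VS = {:L}%VS).
Hypothesis f_min : minPoly 1%VS theta = map_poly (in_alg L) f.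
Hypothesis f_sep : separable_presentation p f fsep n.

Local Notation s := (size fsep).-1.
Local Notation m := (m_of L p fsep n).
Local Notation Lsep := (max_sep 1%AS {:L}%AS).
Local Notation Lpi := (max_pi 1%AS {:L}%AS).
Local Notation M := (Lpi * Lsep)%AS.
Local Notation all_roots k :=
  (forall i, (i < s)%N -> has_pth_root p k ((fsep`_i)%:A : L)).

Let charL : p \in [pchar L].
Proof. by rewrite pchar_lalg. Qed.

Let expp_gt0 k : (0 < p ^ k)%N.
Proof. by rewrite expn_gt0 prime_gt0 ?(pcharf_prime charK). Qed.

Let compXn_size (q : {poly K}) :
  (size (q \Po 'X^(p ^ n))).-1 = ((size q).-1 * p ^ n)%N.
Proof. by rewrite size_comp_poly size_polyXn. Qed.

Let horner_compXn (q : {poly K}) :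
  (map_poly (in_alg L) (q \Po 'X^(p ^ n))).[theta] =
  (map_poly (in_alg L) q).[theta ^+ (p ^ n)].
Proof. by rewrite map_comp_poly horner_comp map_polyXn hornerXn. Qed.

Lemma fsep_monic : fsep \is monic.
Proof.
have mf : f \is monic by rewrite -(map_monic (in_alg L)) -f_min monic_minPoly.
move: mf; rewrite f_sep.2 !monicE lead_coef_comp ?size_polyXn ?ltnS //.
by rewrite lead_coefXn expr1n mulr1.
Qed.

Lemma size_fsep : size fsep = s.+1.
Proof. by rewrite prednK // size_poly_gt0 monic_neq0 ?fsep_monic. Qed.

(** If q is the minimal polynomial of theta^(p^n), then q(x^(p^n)) vanishes at theta, so f divides
    it; cancelling p^n in the degrees gives s <= deg q. *)
Lemma minPoly_theta_expr :
  minPoly 1%VS (theta ^+ (p ^ n)) = map_poly (in_alg L) fsep.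
Proof.
have root_theta : root (minPoly 1%VS theta) theta := root_minPoly 1%AS theta.
apply: (@minPoly_unique _ _ 1%AS); rewrite ?alg_polyOver ?map_monic ?fsep_monic //.
  by rewrite /root -horner_compXn -f_sep.2 -f_min.
have /polyOver1P[q def_q] := minPolyOver 1%AS (theta ^+ (p ^ n)).
have nzq : q != 0.
  by rewrite -(map_poly_eq0 (in_alg L)) -def_q monic_neq0 ?monic_minPoly.
have qtheta : root (map_poly (in_alg L) (q \Po 'X^(p ^ n))) theta.
  by rewrite /root horner_compXn -def_q minPolyxx.
have nzqX : q \Po 'X^(p ^ n) != 0.
  by rewrite comp_poly_eq0 // size_polyXn ltnS.
have := minPoly_dvdp (alg_polyOver 1%AS _) qtheta.
rewrite [minPoly _ _]f_min dvdp_map => /(dvdp_leq nzqX).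
rewrite def_q !size_map_poly f_sep.2.
rewrite -[size (fsep \Po _)]prednK ?size_poly_gt0; last first.
  by rewrite comp_poly_eq0 ?monic_neq0 ?fsep_monic // size_polyXn ltnS.
rewrite -[size (q \Po _)]prednK ?size_poly_gt0 // ltnS !compXn_size.
rewrite leq_pmul2r // => le_s.
by rewrite size_fsep -[size q]prednK ?size_poly_gt0.
Qed.

Lemma s_gt0 : (0 < s)%N.
Proof.
have := size_minPoly 1 (theta ^+ (p ^ n)).
by rewrite minPoly_theta_expr size_map_poly => ->.
Qed.

Lemma dim_theta : \dim {:L} = (s * p ^ n)%N.
Proof.
rewrite -L_gen (dim_Fadjoin 1%AS) dimv1 muln1 -[LHS]/(_.+1.-1) -size_minPoly.
by rewrite f_min size_map_poly f_sep.2 compXn_size.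
Qed.

Lemma theta_expr_separable : separable_element 1 (theta ^+ (p ^ n)).
Proof.
by rewrite /separable_element minPoly_theta_expr separable_map f_sep.1.
Qed.

Lemma Fadjoin_theta (F : {subfield L}) : <<F; theta>>%VS = {:L}%VS.
Proof. by apply/eqP; rewrite eqEsubv subvf -L_gen adjoinSl ?sub1v. Qed.

Lemma theta_exprD i j : (theta ^+ (p ^ i)) ^+ (p ^ j) = theta ^+ (p ^ (i + j)).
Proof. by rewrite -exprM expnD. Qed.

Lemma expr_mem_theta k (F : {subfield L}) v :
  theta ^+ (p ^ k) \in F -> v ^+ (p ^ k) \in F.
Proof.
by move/(expr_Fadjoin_mem charL); apply; rewrite Fadjoin_theta memvf.
Qed.

Lemma purely_inseparable_theta k (F : {subfield L}) :
  theta ^+ (p ^ k) \in F -> purely_inseparable F {:L}.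
Proof.
by move/(purely_inseparable_Fadjoin charL); rewrite Fadjoin_theta.
Qed.

Lemma LsepE : (Lsep : {vspace L}) = <<1%VS; theta ^+ (p ^ n)>>%VS.
Proof.
have -> // : Lsep = <<1; theta ^+ (p ^ n)>>%AS.
apply: max_sep_unique; rewrite ?sub1v ?subvf //.
  by rewrite -adjoin_separable_eq theta_expr_separable.
by apply: (@purely_inseparable_theta n); rewrite memv_adjoin.
Qed.

Lemma dim_Lsep : \dim Lsep = s.
Proof.
rewrite LsepE (dim_Fadjoin 1%AS) dimv1 muln1 -[LHS]/(_.+1.-1) -size_minPoly.
by rewrite minPoly_theta_expr size_map_poly.
Qed.

Lemma Lpi_purely_inseparable : purely_inseparable 1 Lpi.
Proof. by have [] := max_piP (subvf (1%AS : {subfield L})). Qed.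

Lemma memv_Lpi k y : y ^+ (p ^ k) \in 1%VS -> y \in Lpi.
Proof.
move=> y1; have [_ _ maxLpi] := max_piP (subvf (1%AS : {subfield L})).
have /subvP-> // : (<<1; y>> <= Lpi)%VS; last exact: memv_adjoin.
apply: maxLpi; first by rewrite sub1v subvf.
exact: purely_inseparable_Fadjoin y1.
Qed.

(** This is the linear disjointness of L^pi and L^sep: it fixes the degree of the compositum over
    L^pi. *)
Lemma minPoly_Lpi_theta_expr :
  minPoly Lpi (theta ^+ (p ^ n)) = map_poly (in_alg L) fsep.
Proof.
rewrite -minPoly_theta_expr; apply: (minPoly_purely_inseparable charL).
- exact: sub1v.
- exact: Lpi_purely_inseparable.
- exact: theta_expr_separable.
Qed.

Lemma compositumE : (M : {vspace L}) = <<Lpi; theta ^+ (p ^ n)>>%VS.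
Proof.
apply/eqP; rewrite eqEsubv; apply/andP; split.
  rewrite -[X in (_ <= X)%VS]prodv_id prodvS ?subv_adjoin //.
  by rewrite LsepE adjoinSl ?sub1v.
apply/FadjoinP; rewrite field_subvMr (subvP (field_subvMl _ _)) //.
by rewrite LsepE memv_adjoin.
Qed.

Lemma dim_compositum : \dim M = (s * \dim Lpi)%N.
Proof.
rewrite compositumE dim_Fadjoin; congr (_ * _)%N.
by rewrite -[LHS]/(_.+1.-1) -size_minPoly minPoly_Lpi_theta_expr size_map_poly.
Qed.

Lemma dim_Lpi_compositum : \dim_Lpi M = s.
Proof. by rewrite dim_compositum mulnK ?adim_gt0. Qed.

Lemma theta_expr_mem : theta ^+ (p ^ n) \in M.
Proof. by rewrite memvE compositumE -memvE memv_adjoin. Qed.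

Lemma max_sep_Lpi : max_sep Lpi {:L}%AS = M.
Proof.
apply: max_sep_unique; first by rewrite field_subvMr subvf.
  rewrite compositumE -adjoin_separable_eq.
  exact: separable_elementS (sub1v _) theta_expr_separable.
exact: purely_inseparable_theta theta_expr_mem.
Qed.

Lemma compositum_subv_Fadjoin k : (k <= n)%N ->
  (M <= <<Lpi; theta ^+ (p ^ (n - k))>>)%VS.
Proof.
move=> le_kn; rewrite compositumE; apply/FadjoinP; rewrite subv_adjoin.
have <- : theta ^+ (p ^ (n - k)) ^+ (p ^ k) = theta ^+ (p ^ n).
  by rewrite theta_exprD subnK.
by rewrite rpredX ?memv_adjoin.
Qed.

(** * The polynomial with p^k-th roots of the coefficients of [fsep] *)

Section RootPoly.
Variable k : nat.
Hypothesis rootsk : all_roots k.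
Local Notation gk := (root_poly L p k fsep).

(** Roots are assumed only below the leading coefficient; the others are 1, and 0 beyond the
    degree. *)
Lemma all_rootsW i : has_pth_root p k ((fsep`_i)%:A : L).
Proof.
have [lti | gti | ->] := ltngtP i s; first exact: rootsk.
  rewrite nth_default 1?size_fsep //; exists 0.
  by rewrite scale0r expr0n gtn_eqF.
by exists 1; rewrite -lead_coefE (monicP fsep_monic) scale1r expr1n.
Qed.

Lemma coef_root_poly i : gk`_i = pth_root p k ((fsep`_i)%:A : L).
Proof.
have -> : gk = \poly_(j < size fsep) pth_root p k ((fsep`_j)%:A : L).
  by rewrite poly_def.
rewrite coef_poly; case: ltnP => // lei.
rewrite nth_default // scale0r; apply/esym/(pth_root_unique charL).
by rewrite expr0n gtn_eqF.
Qed.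

(** The size, monicity and separability of [gk], and its root, are all read off from [fsep] through
    this identity, Frobenius being injective. *)
Lemma root_polyK :
  map_poly (Frobenius_pow k charL) gk = map_poly (in_alg L) fsep.
Proof.
apply/polyP => i; rewrite !coef_map /= coef_root_poly.
exact/pth_rootP/all_rootsW.
Qed.

Lemma size_root_poly : size gk = s.+1.
Proof.
rewrite -(size_map_poly (Frobenius_pow k charL)) root_polyK.
by rewrite size_map_poly size_fsep.
Qed.

Lemma root_poly_monic : gk \is monic.
Proof.
by rewrite -(map_monic (Frobenius_pow k charL)) root_polyK map_monic fsep_monic.
Qed.

Lemma pth_root_Lpi i : pth_root p k ((fsep`_i)%:A : L) \in Lpi.
Proof.
apply: (@memv_Lpi k); rewrite pth_rootP ?rpredZ ?mem1v //; exact: all_rootsW.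
Qed.

Lemma root_polyOver : gk \is a polyOver Lpi.
Proof. by apply/polyOverP => i; rewrite coef_root_poly pth_root_Lpi. Qed.

Lemma root_poly_root : (k <= n)%N -> root gk (theta ^+ (p ^ (n - k))).
Proof.
move=> le_kn; have : gk.[theta ^+ (p ^ (n - k))] ^+ (p ^ k) == 0.
  rewrite -(horner_Frobenius_pow charL) root_polyK theta_exprD subnK //.
  by rewrite -minPoly_theta_expr (minPolyxx 1%AS).
by rewrite expf_eq0 => /andP[].
Qed.

End RootPoly.

Lemma theta_expr_memP k : (k <= n)%N ->
  theta ^+ (p ^ (n - k)) \in M <-> all_roots k.
Proof.
set x := theta ^+ _ => le_kn.
have xk : x ^+ (p ^ k) = theta ^+ (p ^ n) by rewrite theta_exprD subnK.
split=> [Mx i _ | rootsk]; last first.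
  (* x is separable over M as a root of the separable polynomial [root_poly L p k fsep] over L^pi,
     and purely inseparable over M like every element of L; hence it is in M. *)
  rewrite -separable_inseparable_element; apply/andP; split.
    apply: separable_elementS (field_subvMr _ _) _.
    apply/separable_elementP; exists (root_poly L p k fsep).
    rewrite root_polyOver ?root_poly_root //; split=> //.
    rewrite -(separable_map (Frobenius_pow k charL)) root_polyK //.
    by rewrite separable_map f_sep.1.
  apply/purely_inseparableP: (memvf x).
  exact: purely_inseparable_theta theta_expr_mem.
have defM : (M : {vspace L}) = <<Lpi; x>>%VS.
  apply/eqP; rewrite eqEsubv compositum_subv_Fadjoin //=.
  by apply/FadjoinP; rewrite field_subvMr.
(* The coefficients of the minimal polynomial of x over L^pi are the wanted roots: their p^k-th
   powers form the minimal polynomial of x^(p^k), which is [fsep]. *)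
exists (minPoly Lpi x)`_i.
pose q := map_poly (Frobenius_pow k charL) (minPoly Lpi x).
suffices def_q : minPoly Lpi (theta ^+ (p ^ n)) = q.
  have <- : q`_i = (fsep`_i)%:A.
    by rewrite -def_q minPoly_Lpi_theta_expr coef_map.
  by rewrite coef_map.
apply: minPoly_unique.
- apply/polyOverP => j; rewrite coef_map /= rpredX //.
  exact/polyOverP/minPolyOver.
- by rewrite map_monic monic_minPoly.
- by rewrite /root -xk horner_Frobenius_pow minPolyxx expr0n gtn_eqF.
(* Both x and theta^(p^n) generate M over L^pi, so the degrees agree. *)
rewrite size_map_poly !size_minPoly !adjoin_degreeE -defM.
by rewrite compositumE.
Qed.

Lemma m_ofP : [/\ (m <= n)%N, all_roots m
  & forall k, (k <= n)%N -> all_roots k -> (k <= m)%N].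
Proof.
pose P k := `[< all_roots k >].
have [|le_mn /asboolP rm maxm] := @bigmax_ordP n P.
  by apply/asboolP => i _; exists ((fsep`_i)%:A); rewrite expr1.
by split=> // k le_kn rk; apply: maxm => //; apply/asboolP.
Qed.

Lemma m_le_n : (m <= n)%N.
Proof. by have [] := m_ofP. Qed.

Lemma m_roots : all_roots m.
Proof. by have [] := m_ofP. Qed.

Lemma theta_expr_m_mem : theta ^+ (p ^ (n - m)) \in M.
Proof. exact/(theta_expr_memP m_le_n)/m_roots. Qed.

Lemma m_eq_max_mem : m = (\max_(k < n.+1 | theta ^+ (p ^ (n - k)) \in M) k)%N.
Proof.
have [le_mn rm maxm] := m_ofP.
apply/esym/(@bigmax_ord_eq n (fun k => theta ^+ (p ^ (n - k)) \in M)) => //.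
  exact: theta_expr_m_mem.
by move=> k le_kn /(theta_expr_memP le_kn)/maxm; apply.
Qed.

(** As theta generates L, its p^k-th power decides for all of L. *)
Lemma frobenius_image_sub k (F : {subfield L}) :
  frobenius_image p k {:L}%VS `<=` [set` F] <-> theta ^+ (p ^ k) \in F.
Proof.
split=> [sLF | Fx y [v _ <-]]; last exact: expr_mem_theta.
by apply: sLF; exists theta => //; exact: memvf.
Qed.

Lemma m_eq_max_frobenius : m =
  (\max_(k < n.+1 | `[< frobenius_image p (n - k) {:L}%VS `<=` [set` M] >]) k)%N.
Proof.
rewrite [LHS]m_eq_max_mem; apply: eq_bigl => k.
by apply/idP/asboolP => /frobenius_image_sub.
Qed.

Lemma theta_expr_notin i : (i < n - m)%N -> theta ^+ (p ^ i) \notin M.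
Proof.
move=> lti; apply/negP; have [le_mn _ maxm] := m_ofP.
have le_in : (i <= n)%N by rewrite ltnW // (leq_trans lti) ?leq_subr.
(* With i = n - (n - i), membership would give n - i <= m, against i < n - m. *)
rewrite -{1}(subKn le_in) => /(theta_expr_memP (leq_subr _ _))/maxm.
by move/(_ (leq_subr _ _)); rewrite leqNgt ltn_subCr lti.
Qed.

Lemma minPoly_compositum_theta :
  minPoly M theta = 'X^(p ^ (n - m)) - (theta ^+ (p ^ (n - m)))%:P.
Proof.
apply: (minPoly_expr_pchar charL) theta_expr_m_mem _.
exact: theta_expr_notin.
Qed.

Lemma dim_full_compositum : \dim {:L} = (p ^ (n - m) * \dim M)%N.
Proof.
rewrite -(Fadjoin_theta M) dim_Fadjoin; congr (_ * _)%N; apply: succn_inj.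
by rewrite -size_minPoly minPoly_compositum_theta size_XnsubC.
Qed.

(** Compare s p^n = [L : K] with p^(n-m) s [L^pi : K] and cancel. *)
Lemma dim_Lpi : \dim Lpi = (p ^ m)%N.
Proof.
have := dim_full_compositum; rewrite dim_theta dim_compositum mulnCA.
move/eqP; rewrite eqn_pmul2l ?s_gt0 // -{1}(subnK m_le_n) expnD.
by rewrite eqn_pmul2l // => /eqP.
Qed.

Lemma minPoly_Lpi_root_poly :
  minPoly Lpi (theta ^+ (p ^ (n - m))) = root_poly L p m fsep /\
  (M : {vspace L}) = <<Lpi; theta ^+ (p ^ (n - m))>>%VS.
Proof.
have rm := m_roots; have le_mn := m_le_n.
apply: minPoly_eq_Fadjoin_dim; rewrite ?field_subvMr //.
- exact: root_polyOver.
- exact: root_poly_monic.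
- exact: root_poly_root.
- by rewrite size_root_poly // dim_Lpi_compositum.
exact: compositum_subv_Fadjoin.
Qed.

Lemma LpiE : (Lpi : {vspace L}) =
  <<1%VS & [seq pth_root p m ((fsep`_i)%:A : L) | i <- iota 0 s]>>%VS.
Proof.
set rs := map _ _; have rm := m_roots; have le_mn := m_le_n.
pose E := <<1%AS & rs>>%AS; pose t := theta ^+ (p ^ (n - m)).
apply/esym/eqP; rewrite eqEdim; apply/andP; split.
  apply/(Fadjoin_seqP (K := 1%AS)); split; first exact: sub1v.
  by move=> _ /mapP[i _ ->]; exact: pth_root_Lpi.
(* The coefficients of index at least s are 1 or 0, so the adjoined roots suffice. *)
have Eg : root_poly L p m fsep \is a polyOver E.
  apply/polyOverP => i; rewrite coef_root_poly.
  have [lti | gti | ->] := ltngtP i s.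
  - by apply: seqv_sub_adjoin; apply/mapP; exists i; rewrite ?mem_iota.
  - rewrite nth_default 1?size_fsep // scale0r.
    by rewrite (pth_root_unique (y := 0) charL) ?rpred0 // expr0n gtn_eqF.
  rewrite -lead_coefE (monicP fsep_monic) scale1r.
  by rewrite (pth_root_unique (y := 1) charL) ?rpred1 // expr1n.
have nzg := monic_neq0 (root_poly_monic rm).
(* [L : E] <= [L : E(t)] [E(t) : E] <= p^(n-m) s, which forces
   [E : K] >= p^m = [L^pi : K]. *)
have le_t : (adjoin_degree E t <= s)%N.
  rewrite -ltnS -size_minPoly -(size_root_poly rm) dvdp_leq //.
  by rewrite minPoly_dvdp // root_poly_root.
have le_theta : (adjoin_degree <<E; t>>%AS theta <= p ^ (n - m))%N.
  rewrite -ltnS -size_minPoly -(size_XnsubC t (expp_gt0 (n - m))) dvdp_leq //.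
    by rewrite monic_neq0 // monicXnsubC.
  rewrite minPoly_dvdp ?rpredB ?rpredX ?polyOverX ?polyOverC ?memv_adjoin //.
  by rewrite /root !hornerE subrr.
have := dim_theta; rewrite -(Fadjoin_theta <<E; t>>%AS) !dim_Fadjoin => dimL.
have : (s * p ^ n <= p ^ (n - m) * (s * \dim E))%N.
  by rewrite -dimL leq_mul // leq_mul.
rewrite -{1}(subnK le_mn) expnD mulnCA leq_pmul2l // leq_pmul2l ?s_gt0 //.
by rewrite -dim_Lpi.
Qed.

Lemma compositum_tensor : compositum_is_tensor Lpi Lsep.
Proof.
apply: compositum_is_tensor_dim.
by rewrite [LHS]dim_compositum dim_Lsep mulnC.
Qed.

(** Minimality is witnessed by theta itself, whose smaller p-powers stay outside M. *)
Lemma purely_inseparable_exponent : is_exponent p M {:L} (n - m).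
Proof.
split=> [|e /frobenius_image_sub Me].
  exact/frobenius_image_sub/theta_expr_m_mem.
by rewrite leqNgt; apply: contraL Me => /theta_expr_notin.
Qed.

End SimpleExtension.

(** * Invariance of m under isomorphism *)

Lemma has_pth_root_rmorph (p k : nat) (E F : fieldType)
    (phi : {rmorphism E -> F}) x :
  bijective phi -> has_pth_root p k (phi x) <-> has_pth_root p k x.
Proof.
move=> [psi phiK psiK]; split=> [] [y yk].
  by exists (psi y); apply: (can_inj phiK); rewrite rmorphXn /= psiK.
by exists (phi y); rewrite -yk rmorphXn.
Qed.

Lemma m_of_isom (p : nat) (K : fieldType) (L L' : fieldExtType K)
    (phi : {lrmorphism L -> L'}) (q : {poly K}) n :
  bijective phi -> m_of L' p q n = m_of L p q n.
Proof.
move=> bij_phi; apply: eq_bigl => k.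
have root_iff i :
  has_pth_root p k ((q`_i)%:A : L') <-> has_pth_root p k ((q`_i)%:A : L).
  have <- : phi (q`_i)%:A = (q`_i)%:A by rewrite linearZ /= rmorph1.
  exact: has_pth_root_rmorph.
by apply/asboolP/asboolP => rootsk i lti; apply/root_iff/rootsk.
Qed.

Lemma minPoly1_rmorph (K : fieldType) (L L' : fieldExtType K)
    (phi : {lrmorphism L -> L'}) z :
  minPoly 1%VS (phi z) = map_poly phi (minPoly 1%VS z).
Proof.
have := map_minPoly (linfun_ahom phi) 1%AS z.
rewrite /= aimg1 lfunE /= => <-; apply: eq_map_poly => x.
by rewrite lfunE.
Qed.

(** theta' is carried back to a second generator of L. Both generators then yield p^m = [L^pi : K],
    where L^pi involves no generator. *)
Lemma m_of_invariant (p : nat) (K : fieldType) (L L' : fieldExtType K)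
    (theta : L) (theta' : L') (f fsep f' fsep' : {poly K}) (n n' : nat)
    (phi : {lrmorphism L -> L'}) :
    p \in [pchar K] ->
    <<1%VS; theta>>%VS = {:L}%VS -> <<1%VS; theta'>>%VS = {:L'}%VS ->
    minPoly 1%VS theta = map_poly (in_alg L) f ->
    minPoly 1%VS theta' = map_poly (in_alg L') f' ->
    separable_presentation p f fsep n ->
    separable_presentation p f' fsep' n' -> bijective phi ->
  m_of L' p fsep' n' = m_of L p fsep n.
Proof.
move=> charK gen gen' fmin fmin' fs fs' bij_phi.
have [psi phiK psiK] := bij_phi; rewrite (m_of_isom _ _ _ bij_phi).
have phiA (r : {poly K}) :
  map_poly phi (map_poly (in_alg L) r) = map_poly (in_alg L') r.
  rewrite -map_poly_comp; apply: eq_map_poly => c /=.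
  by rewrite linearZ /= rmorph1.
have gen1 : <<1%VS; psi theta'>>%VS = {:L}%VS.
  apply/eqP; rewrite eqEsubv subvf /=; apply/subvP => v _.
  have : phi v \in <<1; theta'>>%VS by rewrite gen' memvf.
  case/Fadjoin1_polyP => r def_r; apply/Fadjoin1_polyP; exists r.
  by apply: (can_inj phiK); rewrite def_r -horner_map /= psiK phiA.
have fmin1 : minPoly 1%VS (psi theta') = map_poly (in_alg L) f'.
  by apply: (map_poly_inj phi); rewrite -minPoly1_rmorph psiK phiA fmin'.
apply/eqP; rewrite -(eqn_exp2l _ _ (prime_gt1 (pcharf_prime charK))).
by rewrite -(dim_Lpi charK gen1 fmin1 fs') (dim_Lpi charK gen fmin fs).
Qed.

Theorem theorem2p4 (p : nat) (K : fieldType) (L : fieldExtType K)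
    (theta : L) (f fsep : {poly K}) (n : nat)
    (charK : p \in [pchar K])
    (L_gen : <<1%VS; theta>>%VS = {:L}%VS)
    (f_min : minPoly 1%VS theta = map_poly (in_alg L) f)
    (f_sep : separable_presentation p f fsep n) :
  let s := (size fsep).-1 in
  let m := m_of L p fsep n in
  let Lsep := max_sep 1%AS {:L}%AS in
  let Lpi := max_pi 1%AS {:L}%AS in
  let M := (Lpi * Lsep)%AS in
  let g := root_poly L p m fsep in
  let h := 'X^(p ^ (n - m)) - (theta ^+ (p ^ (n - m)))%:P in
  [/\
      [/\ (Lsep : {vspace L}) = <<1%VS; theta ^+ (p ^ n)>>%VS,
          quotient_iso (in_alg L) fsep Lsep (theta ^+ (p ^ n)),
          \dim Lsep = s,
          fsep \is monic /\ irreducible_poly fsep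
        & minPoly 1%VS (theta ^+ (p ^ n)) = map_poly (in_alg L) fsep],
      [/\ (Lpi : {vspace L}) =
            <<1%VS & [seq pth_root p m ((fsep`_i)%:A : L) | i <- iota 0 s]>>%VS,
          \dim Lpi = (p ^ m)%N,
          m = (\max_(m' < n.+1 | theta ^+ (p ^ (n - m')) \in M) m')%N,
          m = (\max_(m' < n.+1 | `[< frobenius_image p (n - m') {:L}%VS
                                     `<=` [set` M] >]) m')%N
        & forall (L' : fieldExtType K) (theta' : L') (f' fsep' : {poly K})
                 (n' : nat),
            <<1%VS; theta'>>%VS = {:L'}%VS ->
            minPoly 1%VS theta' = map_poly (in_alg L') f' ->
            separable_presentation p f' fsep' n' ->
            (exists phi : {lrmorphism L -> L'}, bijective phi) ->
            m_of L' p fsep' n' = m],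
      [/\ compositum_is_tensor Lpi Lsep,
          (M : {vspace L}) = <<Lpi; theta ^+ (p ^ (n - m))>>%VS,
          quotient_iso vsval (poly_in Lpi g) M (theta ^+ (p ^ (n - m))),
          \dim_Lpi M = s /\ \dim_Lsep M = (p ^ m)%N
        & is_irreducible_minPoly Lpi g (theta ^+ (p ^ (n - m)))],
      [/\ {:L}%VS = <<M; theta>>%VS,
          quotient_iso vsval (poly_in M h) {:L}%AS theta,
          \dim_M {:L} = (p ^ (n - m))%N,
          is_irreducible_minPoly M h theta
        & [/\ exists z : L, <<M; z>>%VS = {:L}%VS,
              purely_inseparable M {:L}
            & is_exponent p M {:L} (n - m)]]
    & max_sep Lpi {:L}%AS = M].
Proof.
move=> s m Lsep Lpi M g h.
have min_u := minPoly_theta_expr charK f_min f_sep.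
have [min_t defM] := minPoly_Lpi_root_poly charK L_gen f_min f_sep.
have min_theta := minPoly_compositum_theta charK L_gen f_min f_sep.
(* Presents F as the image of [vsval], as [quotient_iso_Fadjoin] requires over L^pi and over M. *)
have vsval_mem (F : {subfield L}) (x : L) :
  reflect (exists r : subvs_of F, x = vsval r) (x \in F).
  apply: (iffP idP) => [Fx | [r ->]]; last exact: subvsP.
  by exists (Subvs Fx).
split.
- split.
  + exact: LsepE charK L_gen f_min f_sep.
  + apply: (@quotient_iso_Fadjoin _ _ _ (in_alg L) _ 1%AS).
    * by move=> x; apply: vlineP.
    * exact: min_u.
    * exact: LsepE charK L_gen f_min f_sep.
  + exact: dim_Lsep charK L_gen f_min f_sep.
  + exact: minPoly1_irreducible min_u.
  + exact: min_u.
- split.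
  + exact: LpiE charK L_gen f_min f_sep.
  + exact: dim_Lpi charK L_gen f_min f_sep.
  + exact: m_eq_max_mem charK L_gen f_min f_sep.
  + exact: m_eq_max_frobenius charK L_gen f_min f_sep.
  + move=> L' theta' f' fsep' n' gen' fmin' fs' [phi bij_phi].
    exact: m_of_invariant gen' f_min fmin' f_sep fs' bij_phi.
- split.
  + exact: compositum_tensor charK L_gen f_min f_sep.
  + exact: defM.
  + apply: quotient_iso_Fadjoin (vsval_mem Lpi) _ defM.
    by have [gP _ _ _] := minPoly_is_irreducible min_t; rewrite poly_inK.
  + split; first exact: dim_Lpi_compositum charK L_gen f_min f_sep.
    rewrite /M (dim_compositum charK L_gen f_min f_sep).
    rewrite (dim_Lpi charK L_gen f_min f_sep).
    rewrite (dim_Lsep charK L_gen f_min f_sep) mulKn //.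
    exact: s_gt0 charK f_min f_sep.
  + exact: minPoly_is_irreducible.
- have MP := Fadjoin_theta L_gen M; split.
  + by rewrite MP.
  + apply: quotient_iso_Fadjoin (vsval_mem M) _ (esym MP).
    by have [hP _ _ _] := minPoly_is_irreducible min_theta; rewrite poly_inK.
  + rewrite (dim_full_compositum charK L_gen f_min f_sep) mulnK //.
    exact: adim_gt0.
  + exact: minPoly_is_irreducible.
  + split; first by exists theta.
      apply: (purely_inseparable_theta charK L_gen (k := n - m)).
      exact: theta_expr_m_mem charK L_gen f_min f_sep.
    exact: purely_inseparable_exponent charK L_gen f_min f_sep.
- exact: max_sep_Lpi charK L_gen f_min f_sep.
Qed.
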